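(* Let $\Lambda=\{1,\ldots,N_s\}$ with periodic boundary conditions (site $N_s+1$ identified with $1$), $t>0$, $J>0$, and let $$H=-t\sum_{x=1}^{N_s}\sum_{\sigma}(c^\dagger_{x,\sigma}c_{x+1,\sigma}+c^\dagger_{x+1,\sigma}c_{x,\sigma})-J\sum_{x=1}^{N_s}\Big(\hat{\mathbf S}_x\cdot\hat{\mathbf S}_{x+1}-\frac{n_xn_{x+1}}{4}\Big)+U\sum_{x=1}^{N_s}n_{x,\uparrow}n_{x,\downarrow}$$ in the limit $U=\infty$. Assume the electron number $N_e$ is odd and $N_e\le N_s$. Then the ground states have total spin $S_{\rm tot}=S_{\max}=N_e/2$ and are nondegenerate apart from the trivial $(2S_{\max}+1)$-fold degeneracy.
   Context: $c_{x,\sigma}$ are fermion annihilation operators ($x\in\Lambda$, $\sigma\in\{\uparrow,\downarrow\}$) with canonical anticommutation relations and vacuum $\Phi_{\rm vac}$; $\mathcal H_{N_e}$ is the span of $c^\dagger_{x_1,\sigma_1}\cdots c^\dagger_{x_{N_e},\sigma_{N_e}}\Phi_{\rm vac}$; $n_{x,\sigma}=c^\dagger_{x,\sigma}c_{x,\sigma}$, $n_x=n_{x,\uparrow}+n_{x,\downarrow}$; $\hat S^{(\alpha)}_x=\frac12\sum_{\sigma,\tau}c^\dagger_{x,\sigma}(p^{(\alpha)})_{\sigma,\tau}c_{x,\tau}$ with Pauli matrices $p^{(\alpha)}$, $\hat{\mathbf S}_x\cdot\hat{\mathbf S}_y=\sum_\alpha\hat S^{(\alpha)}_x\hat S^{(\alpha)}_y$.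 The $U=\infty$ limit means: with $P_0=\prod_x(1-n_{x,\uparrow}n_{x,\downarrow})$ (projection onto states without doubly occupied sites), one studies $P_0H'P_0$ on $P_0\mathcal H_{N_e}$, where $H'$ is $H$ without the $U$ term; ground states are its lowest-eigenvalue eigenvectors. Total spin operators $S^{(\alpha)}_{\rm tot}=\sum_x\hat S^{(\alpha)}_x$; total spin $S_{\rm tot}$ means $\sum_\alpha(S^{(\alpha)}_{\rm tot})^2=S_{\rm tot}(S_{\rm tot}+1)$ on the state. ''Nondegenerate apart from the trivial $(2S_{\max}+1)$-fold degeneracy'' means the ground-state eigenspace has dimension exactly $2S_{\max}+1$ and all ground states have $S_{\rm tot}=S_{\max}$. *)

(* Defs.v *)
From HB Require Import structures.
From mathcomp Require Import all_boot all_order all_algebra.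
Set Implicit Arguments. Unset Strict Implicit. Unset Printing Implicit Defensive.
Import Order.TTheory GRing.Theory Num.Theory.
Local Open Scope ring_scope.

(* Sites x : 'I_Ns (site x corresponds to x+1 of the paper), periodic
   successor ordS x = x+1 mod Ns.  Spin sigma : bool, true = up, false = down. *)
Definition mode (Ns : nat) := ('I_Ns * bool)%type.

(* Fock space of the 2 Ns fermionic modes: coefficient functions on the
   occupation basis |S> = c^dag_{m1} ... c^dag_{mk} Phi_vac, m1 < ... < mk
   (mode order given by enum_rank), S = {m1,...,mk}. *)
Definition state (C : numClosedFieldType) (Ns : nat) := {ffun {set mode Ns} -> C^o}.

Definition below (Ns : nat) (m : mode Ns) (S : {set mode Ns}) : {set mode Ns} :=
  [set m' in S | (val (enum_rank m') < val (enum_rank m))%N].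

Definition fsign (C : numClosedFieldType) (Ns : nat) (m : mode Ns) (S : {set mode Ns}) : C :=
  (-1) ^+ #|below m S|.

Definition ann (C : numClosedFieldType) (Ns : nat) (m : mode Ns) (v : state C Ns) : state C Ns :=
  [ffun S : {set mode Ns} => if m \in S then 0 else fsign C m S * v (m |: S)].

Definition cre (C : numClosedFieldType) (Ns : nat) (m : mode Ns) (v : state C Ns) : state C Ns :=
  [ffun S : {set mode Ns} => if m \in S then fsign C m S * v (S :\ m) else 0].

Definition numop (C : numClosedFieldType) (Ns : nat) (x : 'I_Ns) (v : state C Ns) : state C Ns :=
  \sum_(s : bool) cre (x, s) (ann (x, s) v).

(* Pauli matrices p^(a), a = 0,1,2 for x,y,z; row/column index true = up *)
Definition pauli (C : numClosedFieldType) (a : 'I_3) (s tau : bool) : C :=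
  match val a with
  | 0 => if s != tau then 1 else 0
  | 1 => if s == tau then 0 else if s then - 'i else 'i
  | _ => if s == tau then (if s then 1 else -1) else 0
  end.

Definition spinop (C : numClosedFieldType) (Ns : nat) (a : 'I_3) (x : 'I_Ns) (v : state C Ns)
  : state C Ns :=
  (2%:R)^-1 *: \sum_(s : bool) \sum_(tau : bool) pauli C a s tau *: cre (x, s) (ann (x, tau) v).

Definition spindot (C : numClosedFieldType) (Ns : nat) (x y : 'I_Ns) (v : state C Ns) : state C Ns :=
  \sum_(a < 3) spinop a x (spinop a y v).

Definition hop (C : numClosedFieldType) (Ns : nat) (x : 'I_Ns) (v : state C Ns) : state C Ns :=
  \sum_(s : bool) (cre (x, s) (ann (ordS x, s) v) + cre (ordS x, s) (ann (x, s) v)).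

Definition Hprime (C : numClosedFieldType) (Ns : nat) (t J : C) (v : state C Ns) : state C Ns :=
  - t *: (\sum_(x < Ns) hop x v)
  - J *: (\sum_(x < Ns) (spindot x (ordS x) v - (4%:R)^-1 *: numop x (numop (ordS x) v))).

Definition no_double (Ns : nat) (S : {set mode Ns}) : bool :=
  [forall x : 'I_Ns, ~~ (((x, true) \in S) && ((x, false) \in S))].

(* P_0 = prod_x (1 - n_{x,up} n_{x,down}) *)
Definition P0 (C : numClosedFieldType) (Ns : nat) (v : state C Ns) : state C Ns :=
  [ffun S : {set mode Ns} => if no_double S then v S else 0].

Definition inP0H (C : numClosedFieldType) (Ns Ne : nat) (v : state C Ns) : Prop :=
  forall S, v S != 0 -> (#|S| == Ne) && no_double S.

(* the U = infinity effective operator P_0 H' P_0 *)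
Definition Heff (C : numClosedFieldType) (Ns : nat) (t J : C) (v : state C Ns) : state C Ns :=
  P0 (Hprime t J (P0 v)).

Definition is_eigpair (C : numClosedFieldType) (Ns Ne : nat) (t J E : C) (v : state C Ns) : Prop :=
  inP0H Ne v /\ v != 0 /\ Heff t J v = E *: v.

Definition ground_energy (C : numClosedFieldType) (Ns Ne : nat) (t J E0 : C) : Prop :=
  (exists v : state C Ns, is_eigpair Ne t J E0 v) /\
  (forall (E : C) (v : state C Ns), is_eigpair Ne t J E v -> E0 <= E).

Definition Stot (C : numClosedFieldType) (Ns : nat) (a : 'I_3) (v : state C Ns) : state C Ns :=
  \sum_(x < Ns) spinop a x v.
Definition Stot2 (C : numClosedFieldType) (Ns : nat) (v : state C Ns) : state C Ns :=
  \sum_(a < 3) Stot a (Stot a v).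

Definition has_dim (C : numClosedFieldType) (Ns : nat) (P : state C Ns -> Prop) (d : nat) : Prop :=
  exists b : d.-tuple (state C Ns),
    (forall i, P (tnth b i)) /\
    (forall a : 'I_d -> C, \sum_(i < d) a i *: tnth b i = 0 -> forall i, a i = 0) /\
    (forall v, P v -> exists a : 'I_d -> C, v = \sum_(i < d) a i *: tnth b i).

(* Main.v *)
Require Import Defs.
From HB Require Import structures.
From mathcomp Require Import all_boot all_order all_algebra all_fingroup.
From mathcomp Require Import ring zify.
Set Implicit Arguments. Unset Strict Implicit. Unset Printing Implicit Defensive.
Import Order.TTheory GRing.Theory Num.Theory.
Local Open Scope ring_scope.
Local Open Scope sesquilinear_scope.

(* For odd [Ne] a hop across the boundary bond carries the sign
   [(-1) ^+ Ne.-1 = 1], so in the occupation basis of states without double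
   occupation every bond acts through the swap of the contents of its two sites:
   as [- t * swap] if exactly one of them is occupied, as [J / 2 * (1 - swap)] if
   both are.  The spinless hopping problem has a positive (Perron-Frobenius)
   ground state [psi], and [u S := psi (sites S)] is an eigenvector of the full
   operator, since the exchange terms annihilate it.  Conjugating by [u] turns the
   quadratic form of [Heff - E0] into a sum of squares of differences of [v / u]
   along the bonds, so [E0] is the lowest energy and [v / u] is constant on the
   orbits of the swaps for every ground state [v].  Those orbits are exactly the
   [Ne.+1] sectors of fixed number of up spins, and in a ground state any two
   spins can be exchanged, which gives the maximal total spin. *)

(** * Lowest eigenvectors of Hermitian matrices *)

Lemma exists_real_min (C : numClosedFieldType) n (D : 'I_n.+1 -> C) :
  (forall i, D i \is Num.real) -> exists i, forall j, D i <= D j.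
Proof.
elim: n D => [|n IHn] D realD; first by exists ord0 => j; rewrite !ord1.
have [i leD] := IHn (fun i => D (lift ord0 i)) (fun i => realD _).
have [le0|/ltW le0] := real_leP (realD ord0) (realD (lift ord0 i)).
  exists ord0 => j; case: (unliftP ord0 j) => [j' ->|-> //].
  exact: le_trans le0 (leD j').
by exists (lift ord0 i) => j; case: (unliftP ord0 j) => [j' ->|->].
Qed.

(** In the coordinates [y] of [w] along an eigenbasis the excess energy is a sum of nonnegative
    terms [(D_j - D_i) |y_j|^2]; if it is at most 0, all of them vanish. The last clause is the
    variational principle by which [|v|] is later recognized as an eigenvector. *)
Lemma hermitian_lowest_eigenvector (C : numClosedFieldType) n (M : 'M[C]_n.+1) :
  M \is hermsymmx ->
  exists (lam : C) (v : 'rV[C]_n.+1),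
    [/\ lam \is Num.real, v != 0, v *m M = lam *: v &
        forall w : 'rV[C]_n.+1,
          (w *m M *m w^t*) 0 0 <= lam * (w *m w^t*) 0 0 -> w *m M = lam *: w].
Proof.
move=> hermM; set P := spectralmx M; set D := spectral_diag M.
have Punit : P \is unitarymx := spectral_unitarymx M.
have eqM : M = P^t* *m diag_mx D *m P.
  rewrite -invmx_unitary //; apply/orthomx_spectralP; exact: hermitian_normalmx.
have PPt : P *m P^t* = 1%:M by apply/unitarymxP.
have PtP : P^t* *m P = 1%:M by rewrite -invmx_unitary // mulVmx // spectral_unit.
have realD j : D 0 j \is Num.real.
  by move/mxOverP: (hermitian_spectral_diag_real hermM); apply.
have [i leD] := exists_real_min realD.
exists (D 0 i), (row i P); split => //.
- apply/eqP => rowP0; have := congr1 (fun A => row i A) PPt.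
  rewrite row_mul rowP0 mul0mx => /rowP/(_ i).
  by rewrite !mxE eqxx => /eqP; rewrite eq_sym oner_eq0.
- rewrite -row_mul eqM !mulmxA PPt mul1mx; apply/rowP => j.
  by rewrite !mxE (bigD1 i) //= big1 ?addr0 ?mxE ?eqxx ?mulr1n //
     => k /negPf nki; rewrite mxE eq_sym nki mulr0n mul0r.
move=> w; set y := w *m P^t*.
have eqw : w = y *m P by rewrite -mulmxA PtP mulmx1.
clearbody y.
have eqwM : w *m M = (y *m diag_mx D) *m P.
  by rewrite eqw eqM !mulmxA -(mulmxA y) PPt mulmx1.
have wt : w^t* = P^t* *m y^t*.
  by rewrite {1}eqw trmx_mul map_mxM.
have -> : w *m M *m w^t* = y *m diag_mx D *m y^t*.
  by rewrite eqwM wt -mulmxA (mulmxA P) PPt mul1mx.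
have -> : w *m w^t* = y *m y^t*.
  by rewrite wt {1}eqw -mulmxA (mulmxA P) PPt mul1mx.
rewrite mul_mx_diag ![(_ *m _) 0 0]mxE mulr_sumr -subr_le0 -sumrB => sum_le0.
have pos j : true -> 0 <= (D 0 j - D 0 i) * `|y 0 j| ^+ 2.
  by rewrite mulr_ge0 ?subr_ge0 // exprn_ge0.
have sum0 : \sum_j (D 0 j - D 0 i) * `|y 0 j| ^+ 2 = 0.
  apply/le_anti; rewrite sumr_ge0 // andbT; apply: le_trans sum_le0.
  rewrite le_eqVlt; apply/orP; left; apply/eqP; apply: eq_bigr => j _.
  by rewrite !mxE normCK; ring.
rewrite eqwM [in RHS]eqw scalemxAl; congr (_ *m _).
rewrite mul_mx_diag; apply/rowP => j; rewrite !mxE.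
move/(psumr_eq0P pos): sum0 => /(_ j isT)/eqP.
rewrite mulf_eq0 subr_eq0 expf_eq0 /= normr_eq0 => /orP[/eqP ->|/eqP ->].
  by rewrite mulrC.
by rewrite mul0r mulr0.
Qed.

(** * Hopping operators along weighted involutions: Dirichlet form and positivity *)

Section SwapOperator.
Variables (C : numClosedFieldType) (T I : finType).
Variables (tau : I -> T -> T) (k : I -> T -> C) (d : T -> C).
Hypothesis tauK : forall i, involutive (tau i).
Hypothesis k_ge0 : forall i S, 0 <= k i S.
Hypothesis k_tau : forall i S, k i (tau i S) = k i S.

(** A discrete Schroedinger operator with potential [d] and hopping amplitude [k i S] along the edge
    from [S] to [tau i S]. Fixed points of [tau i] are allowed and contribute to the diagonal. *)
Definition swapop (v : T -> C) (S : T) : C :=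
  d S * v S - \sum_i k i S * v (tau i S).

Let sum_tau (Q : pred T) i (F : T -> C) : (forall S, Q (tau i S) = Q S) ->
  \sum_(S | Q S) F S = \sum_(S | Q S) F (tau i S).
Proof.
move=> Qt; rewrite (reindex_inj (inv_inj (tauK i))) /=.
by apply: eq_bigl => S; rewrite Qt.
Qed.

(* Ground state transform: twice the quadratic form of [swapop - E0] becomes
   the Dirichlet form of [v / u]. *)
Lemma dirichlet_form (Q : pred T) (u v : T -> C) (E0 E : C) :
  (forall i S, Q (tau i S) = Q S) ->
  (forall S, Q S -> 0 < u S) ->
  (forall S, Q S -> swapop u S = E0 * u S) ->
  (forall S, Q S -> swapop v S = E * v S) ->
  (E - E0) * (2%:R * \sum_(S | Q S) `|v S| ^+ 2) =
  \sum_(S | Q S) \sum_i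
     k i S * (u S * u (tau i S) * `|v S / u S - v (tau i S) / u (tau i S)| ^+ 2).
Proof.
move=> Qt u0 Hu Hv.
pose F i S := k i S * (`|v S| ^+ 2 * u (tau i S) / u S - v (tau i S) * (v S)^*).
have EF : (E - E0) * \sum_(S | Q S) `|v S| ^+ 2 = \sum_(S | Q S) \sum_i F i S.
  rewrite mulr_sumr; apply: eq_bigr => S QS.
  have uS := lt0r_neq0 (u0 S QS).
  have e1 : E * `|v S| ^+ 2 = swapop v S * (v S)^* by rewrite Hv // normCK mulrA.
  (* Testing the equation of [u] against [|v|^2 / u] produces the same diagonal term [d |v|^2],
     which cancels. *)
  have e2 : E0 * `|v S| ^+ 2 = swapop u S * (`|v S| ^+ 2 / u S).
    by rewrite Hu //; field.
  rewrite mulrBl e1 e2 /swapop !mulrBl !mulr_suml.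
  transitivity (\sum_i k i S * u (tau i S) * (`|v S| ^+ 2 / u S)
              - \sum_i k i S * v (tau i S) * (v S)^*).
    by rewrite normCK; field.
  by rewrite -sumrB; apply: eq_bigr => i _; rewrite /F; field.
rewrite mulrCA EF (mulr_natl _ 2) mulr2n.
rewrite exchange_big [RHS]exchange_big -big_split /=; apply: eq_bigr => i _.
(* In the second copy of the sum [S] is replaced by [tau i S]; the two copies together complete a
   square. *)
rewrite {2}(sum_tau _ (Qt i)) -big_split /=; apply: eq_bigr => S QS.
have QtS : Q (tau i S) by rewrite Qt.
have uS := lt0r_neq0 (u0 S QS); have utS := lt0r_neq0 (u0 _ QtS).
have cu : (u S)^* = u S by apply/CrealP/gtr0_real/u0.
have cut : (u (tau i S))^* = u (tau i S) by apply/CrealP/gtr0_real/u0.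
rewrite /F tauK k_tau !normCK rmorphB /= !rmorphM /= !fmorphV /= cu cut; field.
by rewrite uS utS.
Qed.

(** The Dirichlet form is nonnegative and the squared norm of [v] on [Q] is positive. In the partial
    order of [C] this also shows that [E - E0] is real. *)
Lemma swapop_energy_ge (Q : pred T) (u v : T -> C) (E0 E : C) :
  (forall i S, Q (tau i S) = Q S) ->
  (forall S, Q S -> 0 < u S) ->
  (forall S, Q S -> swapop u S = E0 * u S) ->
  (forall S, Q S -> swapop v S = E * v S) ->
  (exists2 S, Q S & v S != 0) -> E0 <= E.
Proof.
move=> Qt u0 Hu Hv [S QS vS].
have norm_gt0 : 0 < 2%:R * \sum_(S | Q S) `|v S| ^+ 2.
  rewrite mulr_gt0 ?ltr0n // (bigD1 S) //= ltr_pwDl //.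
    by rewrite exprn_gt0 // normr_gt0.
  by apply: sumr_ge0 => S' _; rewrite exprn_ge0.
rewrite -subr_ge0 -(pmulr_lge0 _ norm_gt0) (dirichlet_form Qt u0 Hu Hv).
apply: sumr_ge0 => S' QS'; apply: sumr_ge0 => i _.
by rewrite mulr_ge0 // mulr_ge0 ?exprn_ge0 // mulr_ge0 // ltW // u0 // Qt.
Qed.

(** At equal energies the Dirichlet form vanishes, hence so does each of its nonnegative terms. *)
Lemma swapop_ground_ratio (Q : pred T) (u v : T -> C) (E0 : C) :
  (forall i S, Q (tau i S) = Q S) ->
  (forall S, Q S -> 0 < u S) ->
  (forall S, Q S -> swapop u S = E0 * u S) ->
  (forall S, Q S -> swapop v S = E0 * v S) ->
  forall i S, Q S -> k i S != 0 -> v (tau i S) / u (tau i S) = v S / u S.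
Proof.
move=> Qt u0 Hu Hv i S QS kS.
have pos i' S' : Q S' ->
    0 <= k i' S' * (u S' * u (tau i' S')
                    * `|v S' / u S' - v (tau i' S') / u (tau i' S')| ^+ 2).
  move=> QS'.
  by rewrite mulr_ge0 // mulr_ge0 ?exprn_ge0 // mulr_ge0 // ltW // u0 // Qt.
have /esym := dirichlet_form Qt u0 Hu Hv; rewrite subrr mul0r => sum0.
have {}sum0 := psumr_eq0P (fun S' QS' => sumr_ge0 _ (fun i' _ => pos i' S' QS')) sum0 QS.
have /eqP := psumr_eq0P (fun i' _ => pos i' S QS) sum0 (erefl : (fun _ => true) i).
rewrite !mulf_eq0 (negPf kS) (gt_eqF (u0 S QS)) gt_eqF ?u0 ?Qt //=.
by rewrite orbb normr_eq0 subr_eq0 => /eqP ->.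
Qed.

(* Perron-Frobenius: replacing a lowest eigenvector by its entrywise absolute
   value does not increase the energy. *)
Lemma swapop_positive_ground_state (S0 : T) :
  (forall S, d S \is Num.real) ->
  (forall P : pred T, (forall i S, k i S != 0 -> P (tau i S) = P S) ->
     forall S S', P S = P S') ->
  exists (E0 : C) (u : T -> C),
    (forall S, 0 < u S) /\ (forall S, swapop u S = E0 * u S).
Proof.
move=> reald conn.
have [n cardT] : {n | #|T| = n.+1}.
  by exists #|T|.-1; rewrite prednK //; apply/card_gt0P; exists S0.
have [e [r eK rK]] : exists e : 'I_n.+1 -> T, exists2 r, cancel r e & cancel e r.
  exists (fun i => enum_val (cast_ord (esym cardT) i)).
  exists (fun S => cast_ord cardT (enum_rank S)) => S.
    by rewrite cast_ordK enum_rankK.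
  by rewrite enum_valK cast_ordKV.
(* The matrix of [swapop] in an enumeration of [T]; as it is symmetric, it may act on row vectors
   from the right. *)
pose M : 'M[C]_n.+1 := \matrix_(i, j) (d (e i) *+ (i == j)
   - \sum_x k x (e i) *+ (e j == tau x (e i))).
have Msym i j : M i j = M j i.
  rewrite !mxE; congr (_ - _).
    by case: eqVneq => [->|/negPf nij]; rewrite ?eqxx // eq_sym nij.
  apply: eq_bigr => x _; rewrite -(can_eq (tauK x) (e j)) tauK eq_sym.
  by case: eqP => // ->; rewrite k_tau.
have Mreal i j : M i j \is Num.real.
  rewrite mxE rpredB ?rpredMn // rpred_sum // => x _.
  by rewrite rpredMn // ger0_real.
have hermM : M \is hermsymmx.
  apply: realsym_hermsym; last by apply/mxOverP => i j; exact: Mreal.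
  by apply/is_hermitianmxP; rewrite expr0 scale1r map_mx_id //;
     apply/matrixP => i j; rewrite [RHS]mxE Msym.
have actM (w : 'rV[C]_n.+1) S : (w *m M) 0 (r S) = swapop (fun S => w 0 (r S)) S.
  rewrite mxE /swapop.
  transitivity (\sum_j (w 0 j * (d S *+ (r S == j))
     - \sum_x k x S * (w 0 j *+ (e j == tau x S)))).
    apply: eq_bigr => j _; rewrite Msym mxE eK mulrBr; congr (_ - _).
    rewrite mulr_sumr; apply: eq_bigr => x _.
    by case: eqP => _; rewrite ?mulr1n ?mulr0n ?mulr0 // mulrC.
  rewrite sumrB; congr (_ - _).
    rewrite (bigD1 (r S)) //= eqxx mulr1n big1 ?addr0 1?mulrC // => j.
    by rewrite eq_sym => /negPf ->; rewrite mulr0n mulr0.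
  rewrite exchange_big; apply: eq_bigr => x _ /=; rewrite -mulr_sumr; congr (_ * _).
  rewrite (bigD1 (r (tau x S))) //= eK eqxx mulr1n big1 ?addr0 // => j.
  by rewrite -(inj_eq (can_inj rK)) eK => /negPf ->.
have [lam [v [reallam v0 vM lowest]]] := hermitian_lowest_eigenvector hermM.
pose f S := v 0 (r S); pose w : 'rV[C]_n.+1 := map_mx Num.norm v.
have fE S : swapop f S = lam * f S by rewrite -actM vM mxE.
have sum_e (F : 'I_n.+1 -> C) : \sum_i F i = \sum_S F (r S).
  by rewrite (reindex r) //; exists e => ? _.
(* The diagonal terms and the norms of [v] and [w] agree, and the triangle inequality bounds the
   hopping sum [b] of [v] by that of [w]. *)
have wM : w *m M = lam *: w.
  apply: lowest; rewrite ![(_ *m _^t*) 0 0]mxE !sum_e mulr_sumr.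
  under eq_bigr => S _ do rewrite actM !mxE conj_normC.
  under [leRHS]eq_bigr => S _ do rewrite !mxE conj_normC -expr2.
  have wE S : swapop (fun S => w 0 (r S)) S * `|f S| =
      d S * `|f S| ^+ 2 - \sum_i k i S * `|f (tau i S)| * `|f S|.
    rewrite /swapop mulrBl mulr_suml mxE expr2 mulrA; congr (_ - _).
    by apply: eq_bigr => i _; rewrite mxE.
  rewrite (eq_bigr _ (fun S _ => wE S)) sumrB.
  have vE S : lam * `|f S| ^+ 2 =
      d S * `|f S| ^+ 2 - \sum_i k i S * f (tau i S) * (f S)^*.
    by rewrite normCK mulrA -fE /swapop mulrBl mulr_suml mulrA.
  set b := \sum_S \sum_i k i S * f (tau i S) * (f S)^*.
  have eqb : b = \sum_S d S * `|f S| ^+ 2 - \sum_S lam * `|f S| ^+ 2.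
    by rewrite (eq_bigr _ (fun S _ => vE S)) sumrB subKr.
  (* Reality of [b] is what gives [b <= |b|] in the partial order of [C]. *)
  have realb : b \is Num.real.
    by rewrite eqb rpredB // rpred_sum // => S _; rewrite rpredM // rpredX // normr_real.
  have -> : \sum_S lam * `|f S| ^+ 2 = \sum_S d S * `|f S| ^+ 2 - b.
    by rewrite eqb subKr.
  rewrite lerD2l lerN2; apply: le_trans (real_ler_norm realb) _.
  apply: le_trans (ler_norm_sum _ _ _) _; apply: ler_sum => S _.
  apply: le_trans (ler_norm_sum _ _ _) _; apply: ler_sum => i _.
  by rewrite !normrM norm_conjC (ger0_norm (k_ge0 _ _)).
exists lam, (fun S => w 0 (r S)); split=> [S|S]; last by rewrite -actM wM mxE.
(* At a zero of [w] the eigenvalue equation makes a sum of nonnegative terms vanish, so zeros spread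
   along the edges; by connectedness a single zero would force [w = 0]. *)
have inv i S' : k i S' != 0 -> w 0 (r S') == 0 -> w 0 (r (tau i S')) == 0.
  move=> kS /eqP wS; have : swapop (fun S => w 0 (r S)) S' = 0.
    by rewrite -actM wM mxE wS mulr0.
  rewrite /swapop wS mulr0 sub0r => /eqP; rewrite oppr_eq0 psumr_eq0.
    by move=> /allP/(_ i (mem_index_enum _)); rewrite /= mulf_eq0 (negPf kS).
  by move=> i' _; rewrite mulr_ge0 // mxE.
have cst := conn (fun S => w 0 (r S) == 0).
have {}cst : forall S S', (w 0 (r S) == 0) = (w 0 (r S') == 0).
  apply: cst => i S' kS; apply/idP/idP; last exact: inv.
  by rewrite -{2}(tauK i S'); apply: inv; rewrite k_tau.
have w_ge0 : 0 <= w 0 (r S) by rewrite mxE.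
rewrite lt_def w_ge0 andbT; apply: contraNneq v0 => wS0.
apply/eqP/rowP => j; rewrite mxE; apply/eqP; rewrite -normr_eq0.
by have := cst S (e j); rewrite wS0 eqxx rK [w _ _]mxE => <-.
Qed.

End SwapOperator.

(** * Configurations without double occupation and permutations of the sites *)

Section Configurations.
Variable Ns : nat.
Implicit Types (S : {set mode Ns}) (p q : {perm 'I_Ns}) (x y : 'I_Ns).

Definition config (Ne : nat) S := (#|S| == Ne) && no_double S.
Definition occ x S := ((x, true) \in S) || ((x, false) \in S).
Definition sites S : {set 'I_Ns} := [set x | occ x S].
Definition nup S := #|[set x | (x, true) \in S]|.
Definition relabel p S : {set mode Ns} := [set m : mode Ns | (p m.1, m.2) \in S].

Lemma no_doubleP S x s : no_double S -> (x, s) \in S -> (x, ~~ s) \notin S.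
Proof.
move=> /forallP/(_ x); rewrite negb_and; case: s => /=.
  by case/orP => // /negPf ->.
by case/orP => // /negPf ->.
Qed.

Lemma occP S x : reflect (exists s, (x, s) \in S) (occ x S).
Proof.
apply: (iffP orP) => [[xS|xS]|[[] xS]]; [by exists true|by exists false|by left|by right].
Qed.

Lemma relabelM p q S : relabel p (relabel q S) = relabel (p * q)%g S.
Proof. by apply/setP => m; rewrite !inE /= permM. Qed.

Lemma relabel1 S : relabel 1 S = S.
Proof. by apply/setP => -[x s]; rewrite !inE /= perm1. Qed.

Lemma relabel_tpermK x y : involutive (relabel (tperm x y)).
Proof. by move=> S; rewrite relabelM tperm2 relabel1. Qed.

Lemma card_relabel p S : #|relabel p S| = #|S|.
Proof.
have inj : injective (fun m : mode Ns => (p m.1, m.2)).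
  by move=> [x s] [y s'] [/perm_inj -> ->].
by rewrite -(card_preimset S inj); congr #|pred_of_set _|; apply/setP => m; rewrite !inE.
Qed.

Lemma no_double_relabel p S : no_double (relabel p S) = no_double S.
Proof.
apply/forallP/forallP => dbl x; last by rewrite !inE.
by have := dbl ((p^-1)%g x); rewrite !inE /= permKV.
Qed.

Lemma config_relabel Ne p S : config Ne (relabel p S) = config Ne S.
Proof. by rewrite /config card_relabel no_double_relabel. Qed.

Lemma nup_relabel p S : nup (relabel p S) = nup S.
Proof.
rewrite /nup -(card_preimset [set x | (x, true) \in S] (@perm_inj _ p)).
by congr #|pred_of_set _|; apply/setP => m; rewrite !inE.
Qed.

Lemma occ_relabel p S x : occ x (relabel p S) = occ (p x) S.
Proof. by rewrite /occ !inE. Qed.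

Lemma sites_relabel p S : sites (relabel p S) = p @^-1: sites S.
Proof. by apply/setP => x; rewrite !inE occ_relabel. Qed.

(** Without double occupation, forgetting the spin is injective on [S]. *)
Lemma card_sites S : no_double S -> #|sites S| = #|S|.
Proof.
move=> ndS; have -> : sites S = [set m.1 | m in S].
  apply/setP => x; rewrite inE; apply/occP/imsetP => [[s xS]|[[y s] yS ->]].
    by exists (x, s).
  by exists s.
apply: card_in_imset => -[x s] [y s'] xS yS /= exy.
rewrite -{y}exy in yS *; congr (_, _).
by move: (no_doubleP ndS xS) yS; case: s {xS}; case: s' => //= /negPf ->.
Qed.

Let cfg S x := ((x, true) \in S, (x, false) \in S).

Let card_sum (T : finType) (A : {set T}) : #|A| = (\sum_x (x \in A))%N.
Proof. by rewrite -sum1_card big_mkcond; apply: eq_bigr => x _; case: (x \in A). Qed.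

Let card_modes S : #|S| = (nup S + #|[set x | (x, false) \in S]|)%N.
Proof.
rewrite /nup !card_sum -big_split /=.
rewrite (eq_bigr (fun m : mode Ns => nat_of_bool ((m.1, m.2) \in S))); last by case.
rewrite -(pair_bigA _ (fun x s => nat_of_bool ((x, s) \in S))) /=.
by apply: eq_bigr => x _; rewrite big_bool !inE.
Qed.

(** No site holds [(true, true)], so the multiset of site contents is fixed by the numbers of up
    spins, down spins and empty sites. *)
Let count_cfg S (a : pred (bool * bool)) : no_double S ->
  count a [tuple cfg S x | x < Ns] =
  (a (true, false) * nup S + a (false, true) * #|[set x | (x, false) \in S]|
   + a (false, false) * (Ns - #|S|))%N.
Proof.
move=> ndS; have cardC : (Ns - #|S| = #|~: sites S|)%N.
  by rewrite -(card_sites ndS) [RHS]cardsCs setCK card_ord.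
rewrite cardC /nup !card_sum !big_distrr -!big_split /=.
rewrite -sum1_count big_map enumT -/(index_enum _) big_mkcond /=.
apply: eq_bigr => x _; rewrite !inE /occ /cfg.
have := no_doubleP (x := x) (s := true) ndS.
case: (_ \in S) => /= [/(_ isT)/negPf ->|_].
  by case: (a _); rewrite //= !(muln0, muln1, addn0).
by case: (_ \in S); rewrite /= !(muln0, muln1, addn0, add0n); case: (a _).
Qed.

(** By [count_cfg] the two lists of site contents have equal multiplicities, so some permutation of
    the sites carries one to the other. *)
Lemma config_relabel_exists Ne S S' : config Ne S -> config Ne S' ->
  nup S = nup S' -> exists p, S = relabel p S'.
Proof.
move=> /andP[/eqP cS ndS] /andP[/eqP cS' ndS'] eqn.
have : perm_eq [tuple cfg S x | x < Ns] [tuple cfg S' x | x < Ns].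
  apply/seq.permP => a; rewrite !count_cfg // cS cS' eqn; congr (_ + _ * _ + _)%N.
  by apply/eqP; rewrite -(eqn_add2l (nup S)) -card_modes eqn -card_modes cS cS'.
case/tuple_permP => p /val_inj/esym eqp; exists p; apply/setP => -[x s]; rewrite inE /=.
have := congr1 (fun u => tnth u x) eqp; rewrite !tnth_mktuple => -[e1 e2].
by case: s.
Qed.

(** Transpositions of neighbouring sites generate the symmetric group, which acts transitively on
    the configurations with given [Ne] and [nup]. This is the connectedness used both for [v / u]
    and for the spinless problem. *)
Lemma swap_invariant_const Ne (X : Type) (f : {set mode Ns} -> X) :
  (forall x S, config Ne S -> f (relabel (tperm x (ordS x)) S) = f S) ->
  forall S S', config Ne S -> config Ne S' -> nup S = nup S' -> f S = f S'.
Proof.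
move=> fadj.
pose G p := forall S, config Ne S -> f (relabel p S) = f S.
have G1 : G 1%g by move=> S _; rewrite relabel1.
have GM p q : G p -> G q -> G (p * q)%g.
  by move=> Gp Gq S cS; rewrite -relabelM Gp ?config_relabel ?Gq.
have Gadj x : G (tperm x (ordS x)) := fadj x.
have Gle n : forall x y, (y = x + n :> nat)%N -> G (tperm x y).
  elim: n => [|n IHn] x y; first by rewrite addn0 => /val_inj ->; rewrite tperm1.
  move=> eqy; have ltx : (x + n < Ns)%N by have := ltn_ord y; lia.
  pose z := Ordinal ltx; have {}Gz := IHn x z (erefl _).
  have eqz : y = ordS z.
    by apply: val_inj; rewrite /= -addnS -eqy modn_small.
  have Gzy : G (tperm z y) by rewrite eqz.
  have [<- //|nxz] := eqVneq z x.
  (* Conjugation by the swap of [z] and [y] lengthens the transposition of [x] and [z] by one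
     site. *)
  have -> : tperm x y = (tperm x z ^ tperm z y)%g.
    rewrite tpermJ tpermL tpermD //; apply/eqP => /(congr1 val) /=; lia.
  by rewrite conjgE tpermV; apply: (GM _ _ Gzy); apply: (GM _ _ Gz Gzy).
have Gt x y : G (tperm x y).
  have [le|/ltnW le] := leqP x y; first by apply: (Gle (y - x)%N); lia.
  by rewrite tpermC; apply: (Gle (x - y)%N); lia.
have Gall p : G p.
  have [ts -> _] := prod_tpermP p.
  by elim: ts => [|t ts IH]; rewrite ?big_nil ?big_cons //; apply: GM.
move=> S S' cS cS' eqn; have [p ->] := config_relabel_exists cS cS' eqn.
exact: Gall.
Qed.

Lemma card_ord_lt n : (n <= Ns)%N -> #|[set x : 'I_Ns | (x < n)%N]| = n.
Proof.
move=> len; have inj : injective (widen_ord len) by move=> i j [/val_inj].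
rewrite -[RHS]card_ord -(card_imset _ inj).
apply: eq_card => x; rewrite inE; apply/idP/imsetP => [lt|[y _ ->]]; last exact: (ltn_ord y).
by exists (Ordinal lt) => //; apply: val_inj.
Qed.

(** For [M <= Ne <= Ns], a representative of the sector with [M] up spins, at which the coefficients
    of ground states are read off. *)
Definition sector_config (Ne M : nat) : {set mode Ns} :=
  [set m : mode Ns | (m.1 < Ne)%N && (m.2 == (m.1 < M)%N)].

Lemma sector_config_config Ne M : (Ne <= Ns)%N -> config Ne (sector_config Ne M).
Proof.
move=> leN; have nd : no_double (sector_config Ne M).
  by apply/forallP => x; rewrite !inE /=; case: (x < M)%N; rewrite ?andbF.
rewrite /config nd andbT -(card_sites nd) -[X in _ == X](card_ord_lt leN).
apply/eqP/eq_card => x; rewrite !inE /occ !inE /=.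
by case: (x < M)%N; rewrite !(andbT, andbF, orbF).
Qed.

Lemma nup_sector_config Ne M : (M <= Ne)%N -> (Ne <= Ns)%N ->
  nup (sector_config Ne M) = M.
Proof.
move=> leM leN; rewrite -[RHS](card_ord_lt (leq_trans leM leN)).
apply: eq_card => x; rewrite !inE /=; case: ltnP => //=; lia.
Qed.

Lemma nup_le S : no_double S -> (nup S <= #|S|)%N.
Proof.
by move=> nd; rewrite -(card_sites nd) subset_leq_card //; apply/subsetP => x;
   rewrite !inE /occ => ->.
Qed.

End Configurations.

(** * Fermion signs and spin operators in the occupation basis *)

Section Operators.
Variables (C : numClosedFieldType) (Ns : nat).
Implicit Types (S : {set mode Ns}) (x y : 'I_Ns) (v : state C Ns) (m : mode Ns).

(** Modes are ordered site by site, up before down because [bool] is enumerated as [true], [false];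
    the fermion signs below rest on this. *)
Lemma enum_rank_mode x (s : bool) :
  enum_rank ((x, s) : mode Ns) = (2 * x + ~~ s)%N :> nat.
Proof.
rewrite [LHS](_ : _ = index (x, s) (enum {: mode Ns})); last first.
  by rewrite -{2}(nth_enum_rank (x, s) (x, s)) index_uniq ?enum_uniq // -cardE.
have idx (r : seq 'I_Ns) : x \in r ->
    index (x, s) [seq (z, b) | z <- r, b <- [:: true; false]]
    = (2 * index x r + ~~ s)%N.
  elim: r => //= z r IHr; rewrite inE !xpair_eqE (eq_sym x).
  case: (eqVneq z x) => [_ _|nzx /= xr]; first by rewrite muln0; case: s {IHr}.
  by rewrite IHr //; lia.
transitivity (2 * index x (enum 'I_Ns) + ~~ s)%N; last by rewrite index_enum_ord.
rewrite -idx ?mem_enum //; congr index.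
have enumb : enum {: bool} = [:: true; false] by rewrite enumT unlock.
by rewrite [LHS]enumT unlock /= /prod_enum enumb.
Qed.

Lemma cre_annE m m' v S : cre m (ann m' v) S =
  if (m \in S) && (m' \notin S :\ m)
  then fsign C m S * fsign C m' (S :\ m) * v (m' |: (S :\ m)) else 0.
Proof.
rewrite !ffunE; case: (m \in S) => //=.
by case: (m' \in _) => /=; rewrite ?mulr0 ?mulrA.
Qed.

(** The other mode of site [x] is empty, so the sign of [(x, s)] depends only on the earlier
    sites. *)
Lemma belowE x s S : (x, ~~ s) \notin S -> below (x, s) S = [set m in S | (m.1 < x)%N].
Proof.
move=> nS; apply/setP => -[y s']; rewrite !inE /= !enum_rank_mode.
case: (boolP ((y, s') \in S)) => //= yS; apply/idP/idP; last by case: s {nS}; case: s' {yS} => /=; lia.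
have [//|gtx|/val_inj eqx] := ltngtP y x; first by case: s {nS}; case: s' {yS} => /=; lia.
by move: nS yS; rewrite eqx; case: s; case: s' => /= nS; rewrite ?(negPf nS) //; lia.
Qed.

Lemma fsign_mul x y s s' S : (x, ~~ s) \notin S -> (y, ~~ s') \notin S :\ (x, s) ->
  fsign C (x, s) S * fsign C (y, s') (S :\ (x, s)) =
  (-1) ^+ (#|[set m in S | (m.1 < x)%N]| + #|[set m in S :\ (x, s) | (m.1 < y)%N]|).
Proof. by move=> xS yS; rewrite /fsign !belowE // exprD. Qed.

Definition upd x s S : {set mode Ns} :=
  [set m : mode Ns | if m.1 == x then m.2 == s else m \in S].

Lemma no_double_upd x s S : no_double S -> no_double (upd x s S).
Proof.
move=> /forallP nd; apply/forallP => z; rewrite !inE /=.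
by case: eqP (nd z) => // _ _; case: s.
Qed.

Lemma upd_neq x y s s' S : y != x -> ((y, s') \in upd x s S) = ((y, s') \in S).
Proof. by rewrite inE /= => /negPf ->. Qed.

Lemma upd_eq x s s' S : ((x, s') \in upd x s S) = (s' == s).
Proof. by rewrite inE eqxx. Qed.

Lemma upd_upd x s s' S : upd x s (upd x s' S) = upd x s S.
Proof. by apply/setP => m; rewrite !inE; case: (_ == x). Qed.

Lemma upd_id x s S : no_double S -> (x, s) \in S -> upd x s S = S.
Proof.
move=> nd xS; apply/setP => -[y s']; rewrite !inE /=; case: eqP => //= ->.
by have := no_doubleP nd xS; case: s xS; case: s' => /= xS nS; rewrite ?xS ?(negPf nS).
Qed.

(** Turns the spin exchange of the Heisenberg term into a permutation of sites. *)
Lemma upd_swap x y s s' S : no_double S -> x != y -> (x, s) \in S -> (y, s') \in S ->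
  upd y s (upd x s' S) = relabel (tperm x y) S.
Proof.
move=> nd nxy xS yS; apply/setP => -[z r]; rewrite !inE /=.
have [->|nzy] := eqVneq z y; first by rewrite tpermR -{1}(upd_id nd xS) upd_eq.
have [->|nzx] := eqVneq z x; first by rewrite tpermL -{1}(upd_id nd yS) upd_eq.
by rewrite tpermD // eq_sym.
Qed.

(** Both signs count the electrons on the sites before [x], hence they cancel. *)
Lemma cre_ann_site x s s' v S : no_double S ->
  cre (x, s) (ann (x, s') v) S = if (x, s) \in S then v (upd x s' S) else 0.
Proof.
move=> nd; rewrite cre_annE; case: (boolP (_ \in S)) => //= xS.
have noS r : (x, r) \notin S :\ (x, s).
  rewrite !inE xpair_eqE eqxx /=; have := no_doubleP nd xS.
  by case: s xS; case: r => //= _ /negPf ->.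
rewrite noS fsign_mul ?noS ?(no_doubleP nd) //.
have -> : [set m in S :\ (x, s) | (m.1 < x)%N] = [set m in S | (m.1 < x)%N].
  apply/setP => -[y r]; rewrite !inE /= xpair_eqE.
  by have [->|] := eqVneq y x; rewrite ?ltnn ?andbF.
rewrite exprD -expr2 sqrr_sign mul1r; congr (v _).
apply/setP => -[y r]; rewrite in_setU1 !inE /= !xpair_eqE.
have [->|] := eqVneq y x => //=.
by have := noS r; rewrite !inE xpair_eqE eqxx /= => /negPf ->; rewrite orbF.
Qed.

Lemma numopE x v S : no_double S -> numop x v S = if occ x S then v S else 0.
Proof.
move=> nd; rewrite /numop sum_ffunE big_bool /= !cre_ann_site // /occ.
have := no_doubleP (x := x) (s := true) nd.
case: (boolP (_ \in S)) => [xS /(_ isT)/negPf /= ->|_ _] /=.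
  by rewrite addr0 upd_id.
by rewrite add0r; case: (boolP (_ \in S)) => // xS; rewrite upd_id.
Qed.

Lemma spinopE a x s v S : no_double S -> (x, s) \in S ->
  spinop a x v S = 2%:R^-1 * \sum_(tau : bool) pauli C a s tau * v (upd x tau S).
Proof.
move=> nd xS; rewrite /spinop ffunE sum_ffunE; congr (_ * _).
rewrite (bigD1 s) //= [X in _ + X]big1 ?addr0 => [|r nrs].
  by rewrite sum_ffunE; apply: eq_bigr => tau _; rewrite ffunE cre_ann_site // xS.
rewrite sum_ffunE big1 // => tau _; rewrite ffunE cre_ann_site //.
have -> : r = ~~ s by case: r s nrs {xS} => -[].
by rewrite (negPf (no_doubleP nd xS)) scaler0.
Qed.

Lemma spinop_empty a x v S : no_double S -> ~~ occ x S -> spinop a x v S = 0.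
Proof.
move=> nd /occP noS; rewrite /spinop ffunE sum_ffunE big1 ?scaler0 // => s _.
rewrite sum_ffunE big1 // => tau _; rewrite ffunE cre_ann_site //.
by case: (boolP (_ \in S)) => [xS|_]; [case: noS; exists s | rewrite scaler0].
Qed.

(* [\sum_a p^a_(s, r) p^a_(s', r') = 2 (s == r') (r == s') - (s == r) (s' == r')] *)
Lemma pauli_exchange (F : bool -> bool -> C) s s' :
  \sum_(a < 3) 2%:R^-1 * \sum_(r : bool) pauli C a s r *
     (2%:R^-1 * \sum_(r' : bool) pauli C a s' r' * F r r') =
  2%:R^-1 * F s' s - 4%:R^-1 * F s s'.
Proof.
have i2 : 'i * 'i = -1 :> C by rewrite -expr2 sqrCi.
rewrite !big_ord_recl big_ord0 !big_bool /pauli /=.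
by case: s; case: s' => /=; field: i2.
Qed.

(** The factor [3 / 4] is the Casimir value [j (j + 1)] at [j = 1 / 2]. *)
Lemma pauli_square (F : bool -> C) s :
  \sum_(a < 3) 2%:R^-1 * \sum_(r : bool) pauli C a s r *
     (2%:R^-1 * \sum_(r' : bool) pauli C a r r' * F r') = 3%:R / 4%:R * F s.
Proof.
have i2 : 'i * 'i = -1 :> C by rewrite -expr2 sqrCi.
rewrite !big_ord_recl big_ord0 !big_bool /pauli /=.
by case: s => /=; field: i2.
Qed.

Lemma spindotE x y v S : no_double S -> x != y ->
  spindot x y v S = if occ x S && occ y S
    then 2%:R^-1 * v (relabel (tperm x y) S) - 4%:R^-1 * v S else 0.
Proof.
move=> nd nxy; rewrite /spindot sum_ffunE.
case: (boolP (occ x S)) => [/occP[s xS]|nx] /=; last first.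
  by rewrite big1 // => a _; rewrite spinop_empty.
case: (boolP (occ y S)) => [/occP[s' yS]|ny] /=.
  (* [S] is written as a double update by its own spins, so that [pauli_exchange] applies. *)
  rewrite -(upd_swap nd nxy xS yS) -[v S](congr1 v (upd_id nd xS)).
  have yU r : (y, s') \in upd x r S by rewrite upd_neq 1?eq_sym.
  have ndU r := no_double_upd x r nd.
  rewrite -[v (upd x s S)](congr1 v (upd_id (ndU s) (yU s))).
  rewrite -(pauli_exchange (fun r r' => v (upd y r' (upd x r S)))).
  apply: eq_bigr => a _; rewrite (spinopE _ _ nd xS); congr (_ * _).
  by apply: eq_bigr => r _; rewrite (spinopE _ _ (ndU r) (yU r)).
rewrite big1 // => a _; rewrite (spinopE _ _ nd xS) big1 ?mulr0 // => r _.
rewrite spinop_empty ?mulr0 ?no_double_upd //.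
by rewrite /occ !upd_neq 1?eq_sym.
Qed.

(** Serves the diagonal terms of the total spin and the one-site chain, whose bond is a loop. *)
Lemma spindot_same x v S : no_double S ->
  spindot x x v S = if occ x S then 3%:R / 4%:R * v S else 0.
Proof.
move=> nd; rewrite /spindot sum_ffunE.
case: (boolP (occ x S)) => [/occP[s xS]|nx] /=; last first.
  by rewrite big1 // => a _; rewrite spinop_empty.
rewrite -[v S](congr1 v (upd_id nd xS)) -(pauli_square (fun r => v (upd x r S))).
apply: eq_bigr => a _; rewrite (spinopE _ _ nd xS); congr (_ * _).
apply: eq_bigr => r _; rewrite (@spinopE a x r) ?upd_eq ?no_double_upd //.
by congr (_ * (_ * _)); apply: eq_bigr => r' _; rewrite upd_upd.
Qed.

End Operators.

(** * The effective Hamiltonian as a swap operator *)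

Section Hamiltonian.
Variables (C : numClosedFieldType) (Ns : nat).
Implicit Types (S : {set mode Ns}) (x y : 'I_Ns) (v : state C Ns) (m : mode Ns).

Lemma ordS_val x : ((ordS x = x.+1 :> nat) \/ (x.+1 = Ns /\ ordS x = 0 :> nat))%N.
Proof.
have [lt|ge] := ltnP x.+1 Ns; first by left; rewrite /= modn_small.
right; have eqN : x.+1 = Ns by have := ltn_ord x; lia.
by split=> //=; rewrite eqN modnn.
Qed.

Lemma eq_ordS x : (x == ordS x) = (Ns == 1%N).
Proof.
have -> : (x == ordS x) = (x == ordS x :> nat) by [].
by have := ltn_ord (ordS x); case: (ordS_val x) => [->|[eqN ->]]; lia.
Qed.

(* The only electrons that can lie between the two modes are the other
   [#|S| - 1] ones, for a hop across the boundary bond. *)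
Lemma hop_sign x y s S : odd #|S| -> no_double S -> (x, s) \in S -> ~~ occ y S ->
  y = ordS x \/ x = ordS y ->
  fsign C (x, s) S * fsign C (y, s) (S :\ (x, s)) = 1.
Proof.
move=> oddS nd xS ny adj; have noy r : (y, r) \notin S.
  by apply: contra ny => yS; apply/occP; exists r.
rewrite fsign_mul ?(no_doubleP nd xS) //; last by rewrite in_setD1 negb_and noy orbT.
have onx m : m \in S -> (m != (x, s)) = (m.1 != x :> nat).
  case: m => z r zS; rewrite xpair_eqE -val_eqE.
  have [/val_inj ezx|//] /= := eqVneq (z : nat) x.
  by move: zS (no_doubleP nd xS); rewrite ezx; case: (r) (s) => -[] // ->.
have ony m : m \in S -> m.1 != y :> nat.
  case: m => z r zS /=; apply: contraL zS => /eqP/val_inj ->; exact: noy.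
have cardD : ~~ odd #|S :\ (x, s)| by move: oddS; rewrite (cardsD1 (x, s) S) xS.
suff : ~~ odd (#|[set m in S | (m.1 < x)%N]|
               + #|[set m in S :\ (x, s) | (m.1 < y)%N]|).
  by move=> /negPf ev; rewrite -signr_odd ev.
(* No electron lies between consecutive sites, so the two counts coincide and their sum is even. *)
have same : (y = x.+1 :> nat \/ x = y.+1 :> nat) ->
    [set m in S :\ (x, s) | (m.1 < y)%N] = [set m in S | (m.1 < x)%N].
  move=> succ; apply/setP => m; rewrite !inE.
  case: (boolP (m \in S)) => mS; rewrite ?andbF // andbT onx //=.
  have := ony m mS; move: succ; lia.
have far0 z : z = 0%N :> nat -> [set m in S | (m.1 < z)%N] = set0.
  by move=> ->; apply/setP => m; rewrite !inE ltn0 andbF.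
have far0' z : z = 0%N :> nat -> [set m in S :\ (x, s) | (m.1 < z)%N] = set0.
  by move=> ->; apply/setP => m; rewrite !inE ltn0 andbF.
have [succ|[[yN x0]|[xN y0]]] : (y = x.+1 :> nat \/ x = y.+1 :> nat) \/
    ((y.+1 = Ns /\ x = 0 :> nat) \/ (x.+1 = Ns /\ y = 0 :> nat))%N.
- case: adj => e.
    by case: (ordS_val x) => [h|[h1 h2]]; rewrite e; [left; left|right; right].
  by case: (ordS_val y) => [h|[h1 h2]]; rewrite e; [left; right|right; left].
- by rewrite same // addnn odd_double.
(* Across the boundary, in either direction, one count is empty and the other comprises all
   remaining electrons, an even number. *)
- rewrite far0 // cards0 add0n.
  rewrite (_ : [set m in _ | _] = S :\ (x, s)) //; apply/setP => m; rewrite !inE.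
  case: (boolP (m \in S)) => mS; rewrite ?andbF // andbT.
  by have := ony m mS; have := ltn_ord m.1; case: (m != _) => //=; lia.
- rewrite far0' // cards0 addn0.
  rewrite (_ : [set m in _ | _] = S :\ (x, s)) //; apply/setP => m; rewrite !inE.
  case: (boolP (m \in S)) => mS; rewrite ?andbF // andbT onx //.
  by have := ltn_ord m.1; rewrite /=; lia.
Qed.

Lemma inP0H_out Ne v S : inP0H Ne v -> ~~ config Ne S -> v S = 0.
Proof. by move=> hv; apply: contraNeq => /hv. Qed.

Lemma cre_ann_hop Ne x y s v S : odd Ne -> inP0H Ne v -> config Ne S ->
  x != y -> y = ordS x \/ x = ordS y ->
  cre (x, s) (ann (y, s) v) S =
  if ((x, s) \in S) && ~~ occ y S then v (relabel (tperm x y) S) else 0.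
Proof.
move=> oddN hv /andP[/eqP cS nd] nxy adj; rewrite cre_annE.
case: (boolP (_ \in S)) => //= xS; case: (boolP (occ y S)) => [/occP[r yS]|ny] /=.
  (* If [(y, s)] is free, the electron at [y] has the opposite spin, and [v] is evaluated where [y]
     is doubly occupied, so it vanishes. *)
  case: ifP => // yD; rewrite (inP0H_out hv) ?mulr0 //.
  have nyx : (y, r) \in S :\ (x, s) by rewrite in_setD1 yS andbT xpair_eqE eq_sym (negPf nxy).
  rewrite /config negb_and; apply/orP; right; apply/negP => /forallP/(_ y)/negP[].
  rewrite !in_setU1 !xpair_eqE eqxx /=.
  have {yD} nrs : r != s by apply: contraNneq yD => ers; rewrite -{1}ers.
  by case: r s nrs {xS yS} nyx => -[] //= _ ->.
have noy r : (y, r) \notin S by apply: contra ny => yS; apply/occP; exists r.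
have yD : (y, s) \notin S :\ (x, s) by rewrite in_setD1 negb_and noy orbT.
rewrite yD hop_sign ?cS // mul1r; congr (v _); apply/setP => -[z r].
rewrite in_setU1 !inE /= !xpair_eqE.
have [->|nzy] := eqVneq z y.
  rewrite tpermR (eq_sym y) (negPf nxy) /= orbC.
  by rewrite (negPf (noy r)) /= -{1}(upd_id nd xS) upd_eq.
rewrite /=; have [->|nzx] := eqVneq z x; last by rewrite tpermD // eq_sym.
by rewrite tpermL (negPf (noy r)) /= -{1}(upd_id nd xS) upd_eq andNb.
Qed.

Lemma hopE Ne x v S : odd Ne -> inP0H Ne v -> config Ne S -> x != ordS x ->
  hop x v S = if occ x S (+) occ (ordS x) S
    then v (relabel (tperm x (ordS x)) S) else 0.
Proof.
move=> oddN hv cS nxy; have nd : no_double S by case/andP: cS.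
have termE s : (cre (x, s) (ann (ordS x, s) v) + cre (ordS x, s) (ann (x, s) v)) S =
    (if ((x, s) \in S) && ~~ occ (ordS x) S then v (relabel (tperm x (ordS x)) S) else 0) +
    (if ((ordS x, s) \in S) && ~~ occ x S then v (relabel (tperm x (ordS x)) S) else 0).
  rewrite [LHS]ffunE (cre_ann_hop s oddN hv cS nxy); last by left.
  by rewrite (cre_ann_hop s oddN hv cS) 1?eq_sym // 1?tpermC //; right.
rewrite /hop sum_ffunE big_bool /= !termE /occ.
have := no_doubleP (x := x) (s := true) nd.
have := no_doubleP (x := ordS x) (s := true) nd.
case: ((x, true) \in S); case: ((ordS x, true) \in S);
  case: ((x, false) \in S); case: ((ordS x, false) \in S) => /= hy hx;
  rewrite ?addr0 ?add0r //; solve [by have := hx isT | by have := hy isT].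
Qed.

Lemma hop_same x v S : no_double S -> x = ordS x ->
  hop x v S = 2%:R * (if occ x S then v S else 0).
Proof.
move=> nd e; rewrite -numopE // /numop /hop -e big_split /= !ffunE.
by rewrite (mulr_natl _ 2) mulr2n.
Qed.

Definition bond_swap x S := relabel (tperm x (ordS x)) S.

(** Minus the coefficient of the swap in the bond term; two empty sites, where the swap is trivial,
    get 0. *)
Definition bond_weight (t J : C) x S : C :=
  if occ x S && occ (ordS x) S then J / 2%:R
  else if occ x S || occ (ordS x) S then t else 0.

(* On a one-site chain the bond joins the site to itself, so that hopping is
   diagonal too. *)
Definition bond_diag (t J : C) S : C :=
  \sum_x (if occ x S && occ (ordS x) S
          then (if Ns == 1%N then - (2%:R * t) else J / 2%:R) else 0).

Lemma P0_id Ne v : inP0H Ne v -> P0 v = v.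
Proof.
move=> hv; apply/ffunP => S; rewrite ffunE; case: (boolP (no_double S)) => // nd.
by rewrite (inP0H_out hv) // /config (negPf nd) andbF.
Qed.

(** The two sides agree bond by bond: by [hopE] and [spindotE] on a proper bond, by [hop_same] and
    [spindot_same] on the loop of a one-site chain. *)
Lemma HeffE Ne (t J : C) v S : odd Ne -> inP0H Ne v -> config Ne S ->
  Heff t J v S = swapop bond_swap (bond_weight t J) (bond_diag t J) v S.
Proof.
move=> oddN hv cS; have nd : no_double S by case/andP: cS.
rewrite /Heff (P0_id hv) ffunE nd /Hprime /swapop /bond_diag.
rewrite !ffunE !sum_ffunE /GRing.scale /= mulr_suml -sumrB.
rewrite mulr_sumr -mulNr mulr_sumr -big_split /=; apply: eq_bigr => x _.
rewrite !ffunE /GRing.scale /= !numopE // -(eq_ordS x) /bond_weight /bond_swap.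
have [e|ne] := eqVneq x (ordS x).
  rewrite hop_same // -!e spindot_same // tperm1 relabel1 andbb orbb.
  by case: (occ x S); field.
rewrite (hopE oddN hv cS) // spindotE //.
by case: (occ x S); case: (occ (ordS x) S) => /=; field.
Qed.

(** * Supports of states and conservation laws *)

Definition supported (R : pred {set mode Ns}) v := forall S, ~~ R S -> v S = 0.

Lemma inP0H_supported Ne v : inP0H Ne v <-> supported (config Ne) v.
Proof.
split=> [hv S|hv S]; first exact: inP0H_out.
by apply: contraNT => /hv ->.
Qed.

Lemma supported_sum R (I : Type) (r : seq I) (F : I -> state C Ns) :
  (forall i, supported R (F i)) -> supported R (\sum_(i <- r) F i).
Proof. by move=> hF S nR; rewrite sum_ffunE big1 // => i _; apply: hF. Qed.

Lemma supportedZ R a v : supported R v -> supported R (a *: v).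
Proof. by move=> hv S nR; rewrite ffunE hv // scaler0. Qed.

Lemma supportedN R v : supported R v -> supported R (- v).
Proof. by move=> hv S nR; rewrite ffunE hv // oppr0. Qed.

Lemma supportedD R v w : supported R v -> supported R w -> supported R (v + w).
Proof. by move=> hv hw S nR; rewrite ffunE hv // hw // addr0. Qed.

Lemma supported_cre_ann_card n m m' v :
  supported (fun S => #|S| == n) v -> supported (fun S => #|S| == n) (cre m (ann m' v)).
Proof.
move=> hv S nS; rewrite cre_annE; case: ifP => // /andP[mS m'S].
by rewrite hv ?mulr0 // cardsU1 m'S; move: nS; rewrite (cardsD1 m S) mS.
Qed.

Lemma supported_cre_ann_site n x s s' v :
  supported (config n) v -> supported (config n) (cre (x, s) (ann (x, s') v)).
Proof.
move=> hv S nS; rewrite cre_annE; case: ifP => // /andP[mS m'S].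
rewrite hv ?mulr0 //; apply: contra nS => /andP[cS nd].
have {}cS : #|S| == n.
  by move: cS; rewrite cardsU1 m'S (cardsD1 (x, s) S) mS.
rewrite /config cS; apply/forallP => z; apply/negP => /andP[zt zf].
have zS r : (z, r) \in S by case: r.
have [ezx|nzx] := eqVneq z x.
  have ess : s' = s.
    by apply/eqP; apply: contraR m'S => ns; rewrite in_setD1 xpair_eqE eqxx (negPf ns) -ezx zS.
  by move/forallP: nd => /(_ z); rewrite ess setD1K // zt zf.
by move/forallP: nd => /(_ z); rewrite !in_setU1 !in_setD1 !xpair_eqE (negPf nzx) /= !zS.
Qed.

Lemma supported_spinop n a x v :
  supported (config n) v -> supported (config n) (spinop a x v).
Proof.
move=> hv; apply: supportedZ; apply: supported_sum => s; apply: supported_sum => r.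
by apply: supportedZ; apply: supported_cre_ann_site.
Qed.

(** Every term of [Hprime] conserves the electron number; hopping may create double occupation,
    which the outer [P0] removes. *)
Lemma Heff_out Ne (t J : C) v S : inP0H Ne v -> ~~ config Ne S -> Heff t J v S = 0.
Proof.
move=> hv nS; rewrite /Heff (P0_id hv) ffunE; case: ifP => // nd.
have {nS} nS : #|S| != Ne by move: nS; rewrite /config nd andbT.
have bil m m' w : supported (fun S => #|S| == Ne) w ->
    supported (fun S => #|S| == Ne) (cre m (ann m' w)) by apply: supported_cre_ann_card.
have hc : supported (fun S => #|S| == Ne) v.
  by move=> S' nS'; rewrite (inP0H_out hv) // /config (negPf nS').
have num x w : supported (fun S => #|S| == Ne) w ->
    supported (fun S => #|S| == Ne) (numop x w).
  by move=> hw; apply: supported_sum => s; apply: bil.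
have spin a x w : supported (fun S => #|S| == Ne) w ->
    supported (fun S => #|S| == Ne) (spinop a x w).
  move=> hw; apply: supportedZ; apply: supported_sum => s.
  by apply: supported_sum => r; apply: supportedZ; apply: bil.
suff : supported (fun S => #|S| == Ne) (Hprime t J v) by apply.
apply: supportedD; [|apply: supportedN]; apply: supportedZ; apply: supported_sum => x.
  by apply: supported_sum => s; apply: supportedD; apply: bil.
apply: supportedD; last by apply: supportedN; apply: supportedZ; apply: (num); apply: (num).
by apply: supported_sum => a; apply: (spin); apply: (spin).
Qed.

End Hamiltonian.

(** * Ground state of the spinless hopping problem *)

Section GroundStates.
Variables (C : numClosedFieldType) (Ns : nat).
Implicit Types (S : {set mode Ns}) (x y : 'I_Ns) (v : state C Ns).
Implicit Types A B D : {set 'I_Ns}.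

Definition site_swap x (A : {set 'I_Ns}) := tperm x (ordS x) @^-1: A.

Lemma site_swapK x : involutive (site_swap x).
Proof. by move=> A; apply/setP => y; rewrite !inE tpermK. Qed.

Lemma site_swap_id x (A : {set 'I_Ns}) : (x \in A) = (ordS x \in A) -> site_swap x A = A.
Proof. by move=> e; apply/setP => y; rewrite inE; case: tpermP => [->|->|]. Qed.

(** Each set of sites is filled by a fully polarized configuration, so this is a case of
    [swap_invariant_const]. *)
Lemma site_swap_invariant_const n (X : Type) (f : {set 'I_Ns} -> X) :
  (forall x A, #|A| = n -> f (site_swap x A) = f A) ->
  forall A B, #|A| = n -> #|B| = n -> f A = f B.
Proof.
move=> fswap A B cA cB.
pose up (D : {set 'I_Ns}) : {set mode Ns} := [set m | (m.1 \in D) && m.2].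
have sites_up D : sites (up D) = D.
  by apply/setP => x; rewrite inE /occ !inE /= andbT andbF orbF.
have nup_up D : nup (up D) = #|D|.
  by apply: eq_card => x; rewrite !inE andbT.
have config_up D : #|D| = n -> config n (up D).
  have nd : no_double (up D) by apply/forallP => x; rewrite !inE /= andbF andbF.
  by move=> cD; rewrite /config nd -card_sites // sites_up cD eqxx.
rewrite -(sites_up A) -(sites_up B).
apply: (@swap_invariant_const _ n _ (fun S => f (sites S))); rewrite ?config_up //.
  move=> x S /andP[/eqP cS nd]; rewrite sites_relabel; apply: fswap.
  by rewrite card_sites.
by rewrite !nup_up cA cB.
Qed.

(** An instance of [swapop_positive_ground_state] on the sets of [Ne] sites. Minimality of the
    energy is not recorded: positivity yields it later, for the full operator, through
    [swapop_energy_ge]. *)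
Lemma spinless_ground_state (Ne : nat) (t : C) : 0 < t -> (Ne <= Ns)%N ->
  exists (E0 : C) (psi : {set 'I_Ns} -> C),
    (forall A, #|A| = Ne -> 0 < psi A) /\
    (forall A, #|A| = Ne ->
       - \sum_x (if (x \in A) (+) (ordS x \in A) then t * psi (site_swap x A) else 0)
       = E0 * psi A).
Proof.
move=> t0 leN; pose T := {A : {set 'I_Ns} | #|A| == Ne}.
have card_swap x (A : T) : #|site_swap x (val A)| == Ne.
  by rewrite card_preimset ?(valP A) //; apply: perm_inj.
pose tau x (A : T) : T := Sub (site_swap x (val A)) (card_swap x A).
pose k x (A : T) : C := if (x \in val A) (+) (ordS x \in val A) then t else 0.
have tauK x : involutive (tau x) by move=> A; apply: val_inj; rewrite /= site_swapK.
have k_ge0 x (A : T) : 0 <= k x A by rewrite /k; case: ifP => // _; apply: ltW.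
have k_tau x (A : T) : k x (tau x A) = k x A.
  by rewrite /k /= !inE tpermL tpermR addbC.
have A0 : T.
  by exists [set x : 'I_Ns | (x < Ne)%N]; rewrite card_ord_lt.
have [|P Pswap A B|E0 [u [u0 Hu]]] :=
    @swapop_positive_ground_state C T _ tau k (fun=> 0) tauK k_ge0 k_tau A0.
- by move=> _; exact: rpred0.
- pose f (D : {set 'I_Ns}) := if insub D is Some D' then P D' else false.
  have fE (D : T) : f (val D) = P D by rewrite /f valK.
  rewrite -!fE.
  apply: (@site_swap_invariant_const Ne); [|exact/eqP/(valP A)|exact/eqP/(valP B)].
  move=> x D /eqP cD; pose D' : T := Sub D cD.
  rewrite (fE (tau x D')) (fE D').
  (* A bond of weight 0 has both sites filled or both empty, and its swap fixes the set. *)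
  have [|k0] := eqVneq (k x D') 0; last exact: Pswap.
  rewrite /k; case: ifP => [_ t_eq0|]; first by rewrite t_eq0 ltxx in t0.
  move=> /negbT; rewrite negb_add => /eqP e _; congr P.
  by apply: val_inj; rewrite /= site_swap_id.
exists E0, (fun A => if insub A is Some A' then u A' else 0).
split=> A /eqP cA; pose A' : T := Sub A cA; rewrite (insubT (fun A => #|A| == Ne) cA) //.
rewrite -Hu /swapop mul0r sub0r; congr (- _); apply: eq_bigr => x _.
rewrite /k /=; case: ifP => _; last by rewrite mul0r.
by rewrite -[site_swap x A]/(val (tau x A')) valK.
Qed.

(** * Total spin of exchange-symmetric states *)

Lemma cre_ann_sum (m m' : mode Ns) (I : finType) (F : I -> state C Ns) :
  cre m (ann m' (\sum_i F i)) = \sum_i cre m (ann m' (F i)).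
Proof.
apply/ffunP => S; rewrite [RHS]sum_ffunE [LHS]cre_annE.
under [RHS]eq_bigr => i _ do rewrite cre_annE.
by case: ifP => _; [rewrite sum_ffunE mulr_sumr | rewrite big1].
Qed.

Lemma spinop_sum a x (I : finType) (F : I -> state C Ns) :
  spinop a x (\sum_i F i) = \sum_i spinop a x (F i).
Proof.
rewrite /spinop -scaler_sumr; congr (_ *: _).
rewrite [RHS]exchange_big; apply: eq_bigr => s _ /=.
rewrite [RHS]exchange_big; apply: eq_bigr => r _ /=.
by rewrite cre_ann_sum scaler_sumr.
Qed.

Lemma Stot2_spindot v : Stot2 v = \sum_x \sum_y spindot x y v.
Proof.
rewrite /Stot2 /Stot /spindot; under eq_bigr => a _ do
  under eq_bigr => x _ do rewrite spinop_sum.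
rewrite exchange_big; apply: eq_bigr => x _; exact: exchange_big.
Qed.

Lemma sum_occ Ne S : config Ne S -> \sum_x (occ x S)%:R = Ne%:R :> C.
Proof.
case/andP=> /eqP cS nd; rewrite -cS -(card_sites nd) -sum1_card natr_sum.
rewrite [RHS]big_mkcond /=; apply: eq_bigr => x _; rewrite inE.
by case: (occ x S).
Qed.

(** Each ordered pair of distinct occupied sites contributes [1/2 - 1/4 = 1/4] and each occupied
    site [3/4], in all [Ne (Ne - 1) / 4 + 3 Ne / 4 = (Ne / 2) (Ne / 2 + 1)]. *)
Lemma Stot2_symmetric Ne v : inP0H Ne v ->
  (forall x y S, config Ne S -> occ x S -> occ y S -> v (relabel (tperm x y) S) = v S) ->
  Stot2 v = ((Ne%:R / 2%:R) * (Ne%:R / 2%:R + 1)) *: v.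
Proof.
move=> hv sym; apply/ffunP => S; rewrite [RHS]ffunE.
have [cS|nS] := boolP (config Ne S); last first.
  rewrite (inP0H_out hv nS) scaler0.
  have /inP0H_supported {}hv := hv.
  apply: (_ : supported (config Ne) (Stot2 v)) nS; apply: supported_sum => a.
  apply: supported_sum => x; apply: supported_spinop; apply: supported_sum => y.
  exact: supported_spinop.
have nd : no_double S by case/andP: cS.
have dotE x y : spindot x y v S =
    (occ x S)%:R * ((occ y S)%:R / 4%:R + (y == x)%:R / 2%:R) * v S.
  have [->|nyx] := eqVneq y x.
    by rewrite spindot_same //; case: (occ x S) => /=; field.
  rewrite spindotE // 1?eq_sym //.
  by case: (boolP (occ x S)) => ox; case: (boolP (occ y S)) => oy /=; rewrite ?sym //; field.
rewrite Stot2_spindot sum_ffunE /GRing.scale /=.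
transitivity (\sum_x (occ x S)%:R * (Ne%:R / 4%:R + 2%:R^-1) * v S).
  apply: eq_bigr => x _; rewrite sum_ffunE; under eq_bigr => y _ do rewrite dotE.
  rewrite -mulr_suml -mulr_sumr big_split /= -!mulr_suml (sum_occ cS).
  rewrite (bigD1 x) //= eqxx big1 => [|y /negPf -> //].
  by rewrite addr0 mul1r.
by rewrite -!mulr_suml (sum_occ cS); field.
Qed.

End GroundStates.

(** * Ground energy, total spin and degeneracy for the ring *)

Theorem mainTheorem9 (C : numClosedFieldType) (Ns Ne : nat) (t J : C) :
  0 < t -> 0 < J -> odd Ne -> (Ne <= Ns)%N ->
  exists E0 : C,
    ground_energy Ns Ne t J E0 /\
    (forall v : state C Ns, is_eigpair Ne t J E0 v ->
       Stot2 v = ((Ne%:R / 2%:R) * (Ne%:R / 2%:R + 1)) *: v) /\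
    has_dim (fun v : state C Ns => inP0H Ne v /\ Heff t J v = E0 *: v) Ne.+1.
Proof.
move=> t0 J0 oddN leN.
have [e0 [psi [psi0 Hpsi]]] := spinless_ground_state t0 leN.
pose u (S : {set mode Ns}) := psi (sites S).
pose K := swapop (@bond_swap Ns) (@bond_weight C Ns t J) (@bond_diag C Ns t J).
(* On a one-site chain the loop gives its electron the energy [- 2 t - J / 2]; on a longer chain the
   exchange terms vanish on [u]. *)
pose c : C := if Ns == 1%N then - (2%:R * t) - J / 2%:R else 0.
have J2 : 0 < J / 2%:R by rewrite divr_gt0 ?ltr0n.
have card_sites_config (S : {set mode Ns}) : config Ne S -> #|sites S| = Ne.
  by case/andP=> /eqP <- nd; rewrite card_sites.
have u0 S : config Ne S -> 0 < u S by move=> cS; apply/psi0/card_sites_config.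
have swapK x : involutive (@bond_swap Ns x) by apply: relabel_tpermK.
have weight_ge0 (x : 'I_Ns) S : 0 <= bond_weight t J x S.
  by rewrite /bond_weight; do 2?case: ifP => // _; apply: ltW.
have weight_swap (x : 'I_Ns) S : bond_weight t J x (bond_swap x S) = bond_weight t J x S.
  by rewrite /bond_weight /bond_swap !occ_relabel tpermL tpermR andbC orbC.
have config_swap (x : 'I_Ns) S : config Ne (bond_swap x S) = config Ne S by apply: config_relabel.
pose E0 := e0 + Ne%:R * c.
have Ku S : config Ne S -> K u S = E0 * u S.
  move=> cS; rewrite /E0 mulrDl -Hpsi ?card_sites_config // -(sum_occ C cS).
  rewrite /K /swapop /bond_diag mulr_suml -sumrB -sumrN mulr_suml mulr_suml -big_split /=.
  apply: eq_bigr => x _; rewrite !inE /bond_weight /c /u sites_relabel -/(site_swap x _).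
  (* If both ends are alike, the swap fixes [sites S] and the bond yields [c] when occupied, 0 when
     empty; otherwise a spinless hop remains. *)
  have [eqO|neqO] := boolP (occ x S == occ (ordS x) S).
    rewrite site_swap_id; last by rewrite !inE (eqP eqO).
    by rewrite -(eqP eqO) addbb andbb orbb; case: (occ x S); case: ifP => _ /=; field.
  have neN : Ns != 1%N.
    by rewrite -(eq_ordS x); apply: contraNneq neqO => <-.
  rewrite (negPf neN) mulr0 mul0r addr0.
  by move: neqO; case: (occ x S); case: (occ (ordS x) S) => //= _; rewrite mul0r sub0r.
have eig_K E (v : state C Ns) : inP0H Ne v -> Heff t J v = E *: v ->
    forall S, config Ne S -> K v S = E * v S.
  by move=> hv Hv S cS; rewrite /K -(HeffE t J oddN hv cS) Hv ffunE.
have ratio (v : state C Ns) : inP0H Ne v -> Heff t J v = E0 *: v ->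
    forall S S', config Ne S -> config Ne S' -> nup S = nup S' -> v S / u S = v S' / u S'.
  move=> hv Hv; apply: (swap_invariant_const (f := fun S => v S / u S)) => x S cS.
  (* A bond weight vanishes only if both sites are empty: since [J > 0], neighbouring electrons can
     be exchanged, which connects all spin patterns of a sector. *)
  have [k0|kn0] := eqVneq (bond_weight t J x S) 0; last first.
    have Kv := eig_K _ _ hv Hv.
    by have := swapop_ground_ratio swapK weight_ge0 weight_swap config_swap u0 Ku Kv cS kn0.
  suff -> : relabel (tperm x (ordS x)) S = S by [].
  have {k0} [nox noy] : ~~ occ x S /\ ~~ occ (ordS x) S.
    move: k0; rewrite /bond_weight; case: (occ x S); case: (occ (ordS x) S) => //= /eqP;
      by rewrite gt_eqF.
  have noS z s : ~~ occ z S -> ((z, s) \in S) = false.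
    by apply: contraNF => zS; apply/occP; exists s.
  by apply/setP => -[y s]; rewrite inE /=; case: tpermP => [->|->|//]; rewrite !noS.
(* The part of [u] with [M] up spins; swaps preserve [nup], so each part is again an eigenvector. *)
pose b (M : nat) : state C Ns := [ffun S => if config Ne S && (nup S == M) then u S else 0].
have bP M : inP0H Ne (b M).
  by apply/inP0H_supported => S nS; rewrite ffunE (negPf nS).
have bH M : Heff t J (b M) = E0 *: b M.
  apply/ffunP => S; rewrite [RHS]ffunE; case: (boolP (config Ne S)) => cS; last first.
    by rewrite (Heff_out _ _ (bP M) cS) (inP0H_out (bP M) cS) scaler0.
  rewrite (HeffE t J oddN (bP M) cS) ffunE cS /=.
  transitivity ((nup S == M)%:R * K u S).
    rewrite /K /swapop mulrBr mulr_sumr ffunE cS /=; congr (_ - _).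
      by case: eqP => _; rewrite ?mul1r // mulr0 mul0r.
    apply: eq_bigr => x _; rewrite ffunE config_swap cS nup_relabel /=.
    by case: eqP => _; rewrite ?mul1r // mulr0 mul0r.
  by rewrite Ku //; case: eqP => _; rewrite ?mul1r // mul0r scaler0.
pose sec (i : nat) := sector_config Ns Ne i.
have secP i : config Ne (sec i) by apply: sector_config_config.
have bsec (i j : 'I_Ne.+1) : b i (sec j) = u (sec j) *+ (i == j).
  rewrite ffunE secP nup_sector_config //; last by rewrite -ltnS.
  by rewrite /= eq_sym val_eqE; case: eqP.
exists E0; split; last split.
(* The sector with all spins down already attains [E0]. *)
- split; first exists (b 0%N).
    split=> //; split=> //; apply/eqP => /ffunP/(_ (sec 0%N)).
    have := bsec ord0 ord0; rewrite /= ?eqxx ?mulr1n => ->; rewrite ffunE => u00.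
    by have := u0 _ (secP 0%N); rewrite u00 ltxx.
  move=> E v [hv [v0 Hv]].
  apply: (swapop_energy_ge swapK weight_ge0 weight_swap config_swap u0 Ku (eig_K _ _ hv Hv)).
  have [S vS] : exists S, v S != 0.
    apply/existsP; apply: contraNT v0; rewrite negb_exists => /forallP v0.
    by apply/eqP/ffunP => S; rewrite ffunE; apply/eqP; rewrite -[_ == _]negbK.
  by exists S => //; apply: contraNT vS => /(inP0H_out hv) ->.
(* Exchanging two occupied sites preserves [sites S], hence [u], and preserves [nup], hence [v / u];
   so [v] is symmetric. *)
- move=> v [hv [_ Hv]]; apply: Stot2_symmetric => // x y S cS ox oy.
  have cS' : config Ne (relabel (tperm x y) S) by rewrite config_relabel.
  have := ratio v hv Hv _ _ cS' cS (nup_relabel _ _).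
  have -> : u (relabel (tperm x y) S) = u S.
    congr psi; apply/setP => z; rewrite !inE occ_relabel.
    by case: tpermP => [->|->|//]; rewrite ox oy.
  by apply: mulIf; rewrite invr_eq0 gt_eqF // u0.
exists [tuple b i | i < Ne.+1]; split; last split.
- by move=> i; rewrite tnth_mktuple.
- move=> a /ffunP sum0 i; have := sum0 (sec i).
  rewrite sum_ffunE ffunE (bigD1 i) //= big1 => [|j nji].
    rewrite ffunE tnth_mktuple bsec eqxx addr0 /GRing.scale /= => /eqP.
    by rewrite mulf_eq0 (gt_eqF (u0 _ _)) // orbF => /eqP.
  by rewrite ffunE tnth_mktuple bsec (negPf nji) scaler0.
(* The coefficients are the constant values of [v / u] on the sectors, read at the
   representatives. *)
move=> v [hv Hv]; exists (fun i : 'I_Ne.+1 => v (sec i) / u (sec i)).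
apply/ffunP => S; rewrite sum_ffunE.
under eq_bigr => i _ do rewrite ffunE tnth_mktuple ffunE.
have [cS|nS] := boolP (config Ne S); last first.
  by rewrite (inP0H_out hv nS) big1 // => i _; rewrite scaler0.
have ltM : (nup S < Ne.+1)%N.
  by case/andP: cS => /eqP <- nd; rewrite ltnS nup_le.
rewrite (bigD1 (Ordinal ltM)) //= eqxx big1 => [|i]; last first.
  by rewrite -val_eqE eq_sym /= => /negPf ->; rewrite scaler0.
rewrite addr0 -(ratio v hv Hv S) ?nup_sector_config // /GRing.scale /=.
by rewrite divfK // gt_eqF // u0.
Qed.
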